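(* Let $1\le k\le n$, and let $\sigma>0$ and $w$ be functions on $\bar\Omega$ that are smooth in $x_k$ on $\bar\Omega$. Let $\hat\sigma$ be any one of the three choices $\hat\sigma_I,\hat\sigma_S,\hat\sigma_G$, used consistently in all the mesh operators below, and let $\sigma^{(k)}$ be either $\sigma$ or $\tilde\sigma^{(k)}$; in the case $\sigma^{(k)}=\tilde\sigma^{(k)}$ assume in addition that $\sigma$ is given and smooth in $x_k$ on $\bar\Omega^{(k)}$. Then $$\Lambda_k(\sigma)w-s_k(\sigma)\big(\sigma^{(k)}L_k(\sigma)w\big)=\mathcal{O}(h_k^4)\quad\text{on } \omega_{\mathbf h}.$$
   Context: Let $n\ge1$, $\Omega=(0,X_1)\times\dots\times(0,X_n)$, and let $\bar\Omega^{(k)}$ be the set obtained from $\bar\Omega$ by replacing $[0,X_k]$ with $[-X_k,2X_k]$. Put $L_k(\sigma)w=\partial_k\big(\frac1\sigma\partial_k w\big)$. Mesh: for each $l$, $h_l=X_l/N_l$ with integer $N_l\ge2$; the nodes are $x_{\mathbf i}=(i_1h_1,\dots,i_nh_n)$, $\mathbf i=(i_1,\dots,i_n)$. The mesh $\bar\omega_{\mathbf h}$ consists of the nodes with $0\le i_l\le N_l$ for all $l$, and $\omega_{\mathbf h}$ consists of the nodes with $1\le i_l\le N_l-1$ for all $l$. $\mathbf e_1,\dots,\mathbf e_n$ is the canonical basis of $\mathbb R^n$, $w_{\mathbf i}=w(x_{\mathbf i})$, and $x_{\mathbf i-0.5\mathbf e_k}=x_{\mathbf i}-0.5h_k\mathbf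 e_k$. Mean values: $\hat\sigma_{\mathbf i-0.5\mathbf e_k}$ denotes one of - $\hat\sigma_{I(\mathbf i-0.5\mathbf e_k)}=\frac1{h_k}\int_{(i_k-1)h_k}^{i_kh_k}\sigma\,dx_k$ (the other coordinates being fixed equal to those of $x_{\mathbf i}$), - $\hat\sigma_{S(\mathbf i-0.5\mathbf e_k)}=\frac16\big(\sigma(x_{\mathbf i-\mathbf e_k})+4\sigma(x_{\mathbf i-0.5\mathbf e_k})+\sigma(x_{\mathbf i})\big)$, - $\hat\sigma_{G(\mathbf i-0.5\mathbf e_k)}=\frac12\big(\sigma(x_{\mathbf i-0.5\mathbf e_k}-\theta_Gh_k\mathbf e_k)+\sigma(x_{\mathbf i-0.5\mathbf e_k}+\theta_Gh_k\mathbf e_k)\big)$, $\theta_G=\frac1{2\sqrt3}$, and $\hat\sigma_{\mathbf i+0.5\mathbf e_k}=\hat\sigma_{(\mathbf i+\mathbf e_k)-0.5\mathbf e_k}$. Also $$\tilde\sigma^{(k)}_{\mathbf i}=\Big[\frac12\Big(\frac1{\hat\sigma_{\mathbf i-0.5\mathbf e_k}}+\frac1{\hat\sigma_{\mathbf i+0.5\mathbf e_k}}\Big)\Big]^{-1}$$ (at nodes with $i_k=0$ or $i_k=N_k$ this uses values of $\sigma$ on $\bar\Omega^{(k)}\setminus\bar\Omega$). In the case $\sigma^{(k)}=\sigma$, $\sigma^{(k)}_{\mathbf i}=\sigma_{\mathbf i}$. Operators: $$\Lambda_k(\sigma)w_{\mathbf i}=\frac1{h_k}\Big(\frac{w_{\mathbf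 i+\mathbf e_k}-w_{\mathbf i}}{\hat\sigma_{\mathbf i+0.5\mathbf e_k}h_k}-\frac{w_{\mathbf i}-w_{\mathbf i-\mathbf e_k}}{\hat\sigma_{\mathbf i-0.5\mathbf e_k}h_k}\Big),\qquad s_k(\sigma)w_{\mathbf i}=\frac1{\sigma^{(k)}_{\mathbf i}}w_{\mathbf i}+\frac{h_k^2}{12}\Lambda_k(\sigma)w_{\mathbf i}.$$ Conventions: ''smooth in $x_k$'' means that the function and all its partial derivatives in $x_k$ of whatever order is needed exist and are continuous on the indicated closed set. ''$=\mathcal O(h_k^4)$ on $\omega_{\mathbf h}$'' means that there are constants $C,h_0>0$, independent of the mesh and the node, such that the absolute value of the left-hand side is at most $Ch_k^4$ at every node of $\omega_{\mathbf h}$ whenever $h_k\le h_0$. *)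

(* Defs.v *)
From HB Require Import structures.
From mathcomp Require Import all_boot all_order all_algebra.
From mathcomp Require Import all_classical all_reals all_analysis.
Import Order.TTheory GRing.Theory Num.Theory.
Import numFieldNormedType.Exports.

Set Implicit Arguments.
Unset Strict Implicit.
Unset Printing Implicit Defensive.

Local Open Scope classical_set_scope.
Local Open Scope ring_scope.

Definition evec (A : pzRingType) (n : nat) (k : 'I_n) : 'rV[A]_n := delta_mx 0 k.

Section Domains.
Context {R : realType} {n : nat}.
Implicit Types (X : 'rV[R]_n) (k : 'I_n).

Definition cbox X : set 'rV[R]_n :=
  [set x | forall l, 0 <= x 0 l <= X 0 l].

Definition ext_cbox X k : set 'rV[R]_n :=
  [set x | forall l, if l == k then - X 0 l <= x 0 l <= 2 * X 0 l
                     else 0 <= x 0 l <= X 0 l].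

End Domains.

Section PartialDerivatives.
Context {R : realType} {n : nat}.
Implicit Types (A : set 'rV[R]_n) (k : 'I_n) (f : 'rV[R]_n -> R).

Definition diff_quotient k f (x : 'rV[R]_n) (t : R) : R :=
  t^-1 * (f (x + t *: evec R k) - f x).

(* Increments t -> 0, t != 0, that keep x + t e_k in A: on the faces x_k = const
   of a closed box this yields one-sided derivatives, and for x in A only the
   values of f on A matter. *)
Definition increments A k (x : 'rV[R]_n) : set_system R :=
  within [set t | A (x + t *: evec R k)] 0^'.

Definition pderivable A k f x : Prop :=
  cvg (diff_quotient k f x @ increments A k x).

Definition pderiv A k f (x : 'rV[R]_n) : R :=
  lim (diff_quotient k f x @ increments A k x).

(* f and its partial derivatives in x_k up to order m exist and are continuous
   on A, jointly in all the variables. *)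
Definition smooth_in (m : nat) A k f : Prop :=
  (forall j, (j < m)%N -> forall x, A x -> pderivable A k (iter j (pderiv A k) f) x)
  /\ (forall j, (j <= m)%N -> {within A, continuous (iter j (pderiv A k) f)}).

Definition Lop A k (sigma w : 'rV[R]_n -> R) : 'rV[R]_n -> R :=
  pderiv A k (fun x => (sigma x)^-1 * pderiv A k w x).

End PartialDerivatives.

Variant mean_rule := IntegralMean | SimpsonMean | GaussMean.

Variant coef_choice := PointCoef | HarmonicCoef.

Section Mesh.
Context {R : realType} {n : nat}.
(* Multi-indices are integer vectors, since i - e_k may lie outside the mesh. *)
Implicit Types (X h : 'rV[R]_n) (N : 'I_n -> nat) (k : 'I_n) (i : 'rV[int]_n).
Implicit Types (sigma w : 'rV[R]_n -> R) (v : 'rV[int]_n -> R).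

Definition mesh_step X N : 'rV[R]_n := \row_l (X 0 l / (N l)%:R).

Definition node h i : 'rV[R]_n := \row_l ((i 0 l)%:~R * h 0 l).

Definition inner_mesh N : set 'rV[int]_n :=
  [set i | forall l, 1 <= i 0 l <= (N l)%:Z - 1].

Definition set_coord (x : 'rV[R]_n) k (t : R) : 'rV[R]_n :=
  \row_l (if l == k then t else x 0 l).

Definition thetaG : R := 1 / (2 * Num.sqrt 3).

(* The mean value at i - 0.5 e_k; the one at i + 0.5 e_k is
   mean r h k sigma (i + e_k). *)
Definition mean (r : mean_rule) h k sigma i : R :=
  let xm := node h i - (h 0 k / 2) *: evec R k in
  match r with
  | IntegralMean =>
      (h 0 k)^-1 *
      \int[lebesgue_measure]_(t in `[((i 0 k)%:~R - 1) * h 0 k, (i 0 k)%:~R * h 0 k])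
        sigma (set_coord (node h i) k t)
  | SimpsonMean =>
      (sigma (node h (i - evec int k)) + 4 * sigma xm + sigma (node h i)) / 6
  | GaussMean =>
      (sigma (xm - (thetaG * h 0 k) *: evec R k)
       + sigma (xm + (thetaG * h 0 k) *: evec R k)) / 2
  end.

Definition coef (c : coef_choice) (r : mean_rule) h k sigma i : R :=
  match c with
  | PointCoef => sigma (node h i)
  | HarmonicCoef =>
      (2^-1 * ((mean r h k sigma i)^-1 + (mean r h k sigma (i + evec int k))^-1))^-1
  end.

Definition Lambda (r : mean_rule) h k sigma v i : R :=
  (h 0 k)^-1 *
  ((v (i + evec int k) - v i) / (mean r h k sigma (i + evec int k) * h 0 k)
   - (v i - v (i - evec int k)) / (mean r h k sigma i * h 0 k)).

Definition sop (c : coef_choice) (r : mean_rule) h k sigma v i : R :=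
  (coef c r h k sigma i)^-1 * v i + h 0 k ^+ 2 / 12 * Lambda r h k sigma v i.

End Mesh.

(* Main.v *)
Require Import Defs.
From HB Require Import structures.
From mathcomp Require Import all_boot all_order all_algebra.
From mathcomp Require Import all_classical all_reals all_analysis.
From mathcomp Require Import ring lra zify.
Import Order.TTheory GRing.Theory Num.Theory.
Import numFieldNormedType.Exports.

Set Implicit Arguments.
Unset Strict Implicit.
Unset Printing Implicit Defensive.

Local Open Scope classical_set_scope.
Local Open Scope ring_scope.

(** Write h for h_k and a prime for the derivative in x_k, and let u = w'/sigma
be the flux, so that w' = sigma u and L w = u'. Over a cell with midpoint m the
difference of w is the integral of sigma u, hence the discrete flux, its
quotient by h times the mean value of sigma, is
[u + h^2/24 (u'' + 2 u' sigma'/sigma)](m) + O(h^4). Subtracting the fluxes of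
the two cells that meet at a node and dividing by h gives
u' + h^2/24 u''' + h^2/24 (u'' + 2 u' sigma'/sigma)'
= L w + h^2/12 ((sigma L w)'/sigma)' up to O(h^4), and the last term is
h^2/12 L(sigma L w), which is h^2/12 Lambda(sigma L w) up to O(h^4). The factor
1/sigma^(k) of s_k cancels sigma^(k) at the central node.

Three points need care. The O(h^4) term of a discrete flux is divided by h
afterwards; it is harmless because it changes only by O(h^5) from one cell to
the next. For this the mean values have to agree with the integral average
through cubics [moment_exact] and to have the same error term on both cells
[moment4_adjacent]. If sigma^(k) is the harmonic mean, then
sigma^(k) = sigma + h^2 a + O(h^4) with a smooth function a, and Lambda turns
h^2 a L w into O(h^2) because it is a second difference; the form of this
expansion at the three nodes involved is [expands_coef]. Finally all bounds must be
uniform over the meshes and the nodes; this comes from the boundedness of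
continuous functions on compact boxes [box_bounded, box_away].

The proof does all this at once, with power series in h at the central node.
A mesh with an inner node is a configuration; [expands h p f c] says that
the quantity f of a configuration is the sum of c_j h^j up to O(h^p),
uniformly. Such expansions can be multiplied and divided. The Taylor
coefficients s_j of sigma and u_j of the flux are the free data: those of w
satisfy (j+1) w_(j+1) = sum of the u_i s_(j-i), and those of L w are
(j+1) u_(j+1) [expands_Lop]. After multiplication by h and by the two mean
values the defect is polynomial in the mesh functions, and its coefficients of
h^0, ..., h^4 vanish identically [defect_expansion]. *)

(** * Expansions in powers of the mesh step *)

Section Asymptotics.
Context {R : realType} {T : Type} (h : T -> R).
Implicit Types (f g : T -> R) (c d : nat -> T -> R) (p q : nat).

(** The limit of vanishing step in a set of configurations: an eventual bound for
this filter is uniform in everything that a configuration contains. *)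
Definition refinement : set_system T :=
  filter_from [set e | 0 < e] (fun e => [set t | h t <= e]).

Global Instance refinement_filter : Filter refinement.
Proof.
apply: filter_from_filter; first by exists 1; rewrite /= ltr01.
move=> a b /= a0 b0; exists (Order.min a b); first by rewrite /= lt_min a0.
by move=> t /=; rewrite le_min => /andP[].
Qed.

Lemma near_refined (e : R) : 0 < e -> \forall t \near refinement, h t <= e.
Proof. by move=> e0; exists e. Qed.

Definition Oh p f : Prop :=
  exists C, \forall t \near refinement, `|f t| <= C * h t ^+ p.

Definition cauchy_prod c d (j : nat) (t : T) : R :=
  \sum_(i < j.+1) c i t * d (j - i)%N t.

(** The coefficients are functions of the configuration because the point of
expansion is a node of the mesh. *)
Definition expands p f c : Prop :=
  (forall j, (j < p)%N -> Oh 0 (c j)) /\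
  Oh p (fun t => f t - \sum_(j < p) c j t * h t ^+ j).

Context (h_gt0 : forall t, 0 < h t).

Let hX_ge0 p t : 0 <= h t ^+ p.
Proof. by rewrite exprn_ge0// ltW. Qed.

Lemma Oh_near p f g : (\forall t \near refinement, f t = g t) -> Oh p g -> Oh p f.
Proof. by move=> fg [C HC]; exists C; apply: filterS2 fg HC => t ->. Qed.

Lemma eq_Oh p f g : f =1 g -> Oh p g -> Oh p f.
Proof. by move=> fg; apply: Oh_near; apply: nearW. Qed.

Lemma Oh_bound p f (C : R) : (forall t, `|f t| <= C * h t ^+ p) -> Oh p f.
Proof. by move=> fC; exists C; apply: nearW. Qed.

Lemma Oh_cst (a : R) : Oh 0 (fun=> a).
Proof. by apply: (@Oh_bound _ _ `|a|) => t; rewrite expr0 mulr1. Qed.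

Lemma Oh0 p : Oh p (fun=> 0).
Proof. by apply: (@Oh_bound _ _ 0) => t; rewrite normr0 mul0r. Qed.

Lemma Oh_hX p : Oh p (fun t => h t ^+ p).
Proof. by apply: (@Oh_bound _ _ 1) => t; rewrite mul1r ger0_norm. Qed.

Lemma Oh_le p q f : (p <= q)%N -> Oh q f -> Oh p f.
Proof.
move=> pq [C HC]; exists `|C|; apply: filterS2 (near_refined ltr01) HC => t h1 ft.
apply: (le_trans ft); apply: (le_trans (ler_wpM2r (hX_ge0 _ _) (ler_norm C))).
by rewrite ler_wpM2l// ler_wiXn2l// ltW.
Qed.

Lemma OhD p f g : Oh p f -> Oh p g -> Oh p (fun t => f t + g t).
Proof.
move=> [C HC] [D HD]; exists (C + D); apply: filterS2 HC HD => t ft gt.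
by rewrite mulrDl (le_trans (ler_normD _ _))// lerD.
Qed.

Lemma OhN p f : Oh p f -> Oh p (fun t => - f t).
Proof. by move=> [C HC]; exists C; apply: filterS HC => t; rewrite normrN. Qed.

Lemma OhB p f g : Oh p f -> Oh p g -> Oh p (fun t => f t - g t).
Proof. by move=> Hf Hg; apply: OhD => //; apply: OhN. Qed.

Lemma OhM p q f g : Oh p f -> Oh q g -> Oh (p + q) (fun t => f t * g t).
Proof.
move=> [C HC] [D HD]; exists (C * D); apply: filterS2 HC HD => t ft gt.
by rewrite normrM exprD mulrACA ler_pM.
Qed.

Lemma OhMl p f g : Oh 0 f -> Oh p g -> Oh p (fun t => f t * g t).
Proof. exact: OhM. Qed.

Lemma OhMr p f g : Oh p f -> Oh 0 g -> Oh p (fun t => f t * g t).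
Proof. by move=> Hf Hg; rewrite -[p]addn0; exact: OhM. Qed.

Lemma Oh_sum p (I : Type) (r : seq I) (P : pred I) (F : I -> T -> R) :
  (forall i, P i -> Oh p (F i)) -> Oh p (fun t => \sum_(i <- r | P i) F i t).
Proof.
move=> HF; elim: r => [|i r IH].
  by apply: eq_Oh (Oh0 p) => t; rewrite big_nil.
case Pi: (P i).
  by apply: eq_Oh (OhD (HF i Pi) IH) => t; rewrite big_cons Pi.
by apply: eq_Oh IH => t; rewrite big_cons Pi.
Qed.

Lemma OhX f j : Oh 0 f -> Oh 0 (fun t => f t ^+ j).
Proof.
move=> Hf; elim: j => [|j IH]; first exact: Oh_cst.
by apply: eq_Oh (OhMl Hf IH) => t; rewrite exprS.
Qed.

Lemma Oh_shift p q f : Oh (p + q) (fun t => h t ^+ p * f t) <-> Oh q f.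
Proof.
split=> [[C HC]|]; last exact/OhM/Oh_hX.
exists C; apply: filterS HC => t.
by rewrite exprD mulrCA normrM ger0_norm// ler_pM2l// exprn_gt0.
Qed.

Definition away f : Prop := exists2 e : R, 0 < e & \forall t \near refinement, e <= f t.

Lemma away_neq0 f : away f -> \forall t \near refinement, f t != 0.
Proof.
by move=> [e e0 He]; apply: filterS He => t; move/(lt_le_trans e0)/lt0r_neq0.
Qed.

Lemma OhV f : away f -> Oh 0 (fun t => (f t)^-1).
Proof.
move=> [e e0 He]; exists e^-1; apply: filterS He => t ft.
have f0 := lt_le_trans e0 ft.
by rewrite expr0 mulr1 gtr0_norm ?invr_gt0// lef_pV2.
Qed.

Lemma awayM f g : away f -> away g -> away (fun t => f t * g t).
Proof.
move=> [a a0 Ha] [b b0 Hb]; exists (a * b); first exact: mulr_gt0.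
by apply: filterS2 Ha Hb => t fa gb; apply: ler_pM => //; exact: ltW.
Qed.

Lemma awayD f g : away f -> away g -> away (fun t => f t + g t).
Proof.
move=> [a a0 Ha] [b b0 Hb]; exists (a + b); first exact: addr_gt0.
by apply: filterS2 Ha Hb => t fa gb; apply: lerD.
Qed.

(** The perturbation is at most half the lower bound of f as soon as the step is
small. *)
Lemma away_perturb f g : away f -> Oh 1 (fun t => g t - f t) -> away g.
Proof.
move=> [e e0 He] [C HC]; exists (e / 2); first by rewrite divr_gt0.
have C0 : 0 < `|C| + 1 by rewrite ltr_wpDl.
have d0 : 0 < e / 2 / (`|C| + 1) by rewrite !divr_gt0.
apply: filterS3 (near_refined d0) He HC => t ht ft; rewrite expr1 => gf.
rewrite ler_pdivlMr// in ht.
have h0 := h_gt0 t; have := ler_norm C; move: gf; rewrite ler_norml => /andP[gf _].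
nra.
Qed.

Lemma expands0 f c : expands 0 f c <-> Oh 0 f.
Proof.
split=> [[_]|Hf]; first by apply: eq_Oh => t; rewrite big_ord0 subr0.
by split=> //; apply: eq_Oh Hf => t; rewrite big_ord0 subr0.
Qed.

Lemma expandsS p f c : expands p.+1 f c <->
  Oh 0 (c 0%N) /\ expands p (fun t => (f t - c 0%N t) / h t) (fun j => c j.+1).
Proof.
have E t : f t - \sum_(j < p.+1) c j t * h t ^+ j =
    h t ^+ 1 * ((f t - c 0%N t) / h t - \sum_(j < p) c j.+1 t * h t ^+ j).
  rewrite big_ord_recl expr0 mulr1 opprD addrA expr1 mulrBr mulrCA.
  rewrite divff ?gt_eqF// mulr1; congr (_ - _).
  by rewrite mulr_sumr; apply: eq_bigr => i _; rewrite mulrCA -exprS.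
split=> [[cO fO]|[c0 [cO fO]]]; split.
- exact: cO.
- by split=> [j jp|]; [exact: cO|apply/(@Oh_shift 1); apply: eq_Oh fO => t; rewrite E].
- by case=> [//|j] jp; exact: cO.
- by apply: (eq_Oh E); apply/(@Oh_shift 1).
Qed.

Lemma eq_expands p f g c d : (\forall t \near refinement, f t = g t) ->
  (forall j t, (j < p)%N -> c j t = d j t) -> expands p g d -> expands p f c.
Proof.
move=> fg cd [dO gO]; split=> [j jp|].
  by apply: eq_Oh (dO j jp) => t; exact: cd.
apply: Oh_near gO; apply: filterS fg => t ->; congr (_ - _).
by apply: eq_bigr => j _; rewrite cd.
Qed.

Lemma expands_le p q f c : (p <= q)%N -> expands q f c -> expands p f c.
Proof.
move=> pq [cO fO]; split=> [j jp|]; first exact/cO/(leq_trans jp).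
rewrite -(subnKC pq) in cO fO.
have tailO : Oh p (fun t => \sum_(j < q - p) c (p + j)%N t * h t ^+ (p + j)).
  apply: Oh_sum => j _; apply: OhMl; first by apply: cO; rewrite ltn_add2l.
  by apply: (@Oh_le _ (p + j)); [rewrite leq_addr|exact: Oh_hX].
have := OhD (Oh_le (leq_addr _ p) fO) tailO; apply: eq_Oh => t.
by rewrite big_split_ord/=; ring.
Qed.

Lemma expandsD p f g c d : expands p f c -> expands p g d ->
  expands p (fun t => f t + g t) (fun j t => c j t + d j t).
Proof.
move=> [cO fO] [dO gO]; split=> [j jp|]; first exact: OhD (cO j jp) (dO j jp).
apply: eq_Oh (OhD fO gO) => t.
by under eq_bigr do rewrite mulrDl; rewrite big_split/=; ring.
Qed.

Lemma expandsZ p f g c : Oh 0 f -> expands p g c ->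
  expands p (fun t => f t * g t) (fun j t => f t * c j t).
Proof.
move=> fO [cO gO]; split=> [j jp|]; first exact: OhMl fO (cO j jp).
apply: eq_Oh (OhMl fO gO) => t.
by under eq_bigr do rewrite -mulrA; rewrite -mulr_sumr mulrBr.
Qed.

Lemma expandsN p f c : expands p f c ->
  expands p (fun t => - f t) (fun j t => - c j t).
Proof.
move=> Hf; apply: eq_expands (expandsZ (Oh_cst (-1)) Hf).
  by apply: nearW => t; rewrite mulN1r.
by move=> j t _; rewrite mulN1r.
Qed.

Lemma expandsB p f g c d : expands p f c -> expands p g d ->
  expands p (fun t => f t - g t) (fun j t => c j t - d j t).
Proof. by move=> Hf Hg; apply: expandsD => //; exact: expandsN. Qed.

Lemma expands_mulh p f c : expands p f c ->
  expands p.+1 (fun t => h t * f t) (fun j t => if j is j'.+1 then c j' t else 0).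
Proof.
move=> Hf; apply/expandsS; split; first exact: Oh0.
apply: eq_expands Hf => //; apply: nearW => t.
by rewrite subr0 mulrAC divff ?gt_eqF// mul1r.
Qed.

(** Write f = c_0 + h f' and g = d_0 + h g'. Then
f g = c_0 d_0 + h (c_0 g' + f' g), and both products in the bracket are needed
to one order less. *)
Lemma expandsM p f g c d : expands p f c -> expands p g d ->
  expands p (fun t => f t * g t) (cauchy_prod c d).
Proof.
elim: p f c g d => [|p IH] f c g d.
  by move=> /expands0 fO /expands0 gO; apply/expands0/OhMl.
move=> /expandsS[c0 Hf] Hg; have /expandsS[d0 Hg'] := Hg.
apply/expandsS; split.
  by apply: eq_Oh (OhMl c0 d0) => t; rewrite /cauchy_prod big_ord1.
have := expandsD (expandsZ c0 Hg') (IH _ _ _ _ Hf (expands_le (leqnSn p) Hg)).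
apply: eq_expands => [|j t jp].
  apply: nearW => t; have hn0 : h t != 0 by rewrite gt_eqF.
  by rewrite /cauchy_prod big_ord1/= subn0; field.
by rewrite /cauchy_prod big_ord_recl subn0.
Qed.

Lemma expands_poly p c : (forall j, (j < p)%N -> Oh 0 (c j)) ->
  expands p (fun t => \sum_(j < p) c j t * h t ^+ j) c.
Proof.
by move=> cO; split=> //; apply: eq_Oh (Oh0 p) => t; rewrite subrr.
Qed.

Lemma expands_small p f c : (forall j t, (j < p)%N -> c j t = 0) ->
  expands p f c -> Oh p f.
Proof.
move=> c0 [_]; apply: eq_Oh => t.
by rewrite big1 ?subr0// => j _; rewrite c0 ?mul0r.
Qed.

(** Multiplied by g, the error f - (sum of the a_j h^j) becomes
k - g (sum of the a_j h^j), and the coefficients of this expansion cancel; since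
g is bounded away from 0, dividing by it keeps the order. *)
Lemma expands_quotient p f g k a b c : away g ->
  (\forall t \near refinement, f t * g t = k t) ->
  (forall j, (j < p)%N -> Oh 0 (a j)) ->
  (forall j t, (j < p)%N -> cauchy_prod a b j t = c j t) ->
  expands p g b -> expands p k c -> expands p f a.
Proof.
move=> ga fgk aO abc Hg Hk; split=> //.
have kO : Oh p (fun t => k t - (\sum_(j < p) a j t * h t ^+ j) * g t).
  apply: expands_small (expandsB Hk (expandsM (expands_poly aO) Hg)) => j t jp.
  by rewrite abc// subrr.
apply: Oh_near (OhMr kO (OhV ga)).
apply: filterS2 fgk (away_neq0 ga) => t fg g0.
by rewrite -fg -mulrBl mulfK.
Qed.

(** Division of power series, the leading coefficient of the divisor being bounded
away from 0. *)
Lemma cauchy_prod_solve p b c : away (b 0%N) ->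
  (forall t, b 0%N t != 0) ->
  (forall j, (j < p)%N -> Oh 0 (b j)) -> (forall j, (j < p)%N -> Oh 0 (c j)) ->
  exists a, (forall j, (j < p)%N -> Oh 0 (a j)) /\
            (forall j t, (j < p)%N -> cauchy_prod a b j t = c j t).
Proof.
move=> b0 b0n; elim: p => [|p IH] bO cO; first by exists (fun _ _ => 0).
have [||a [aO ac]] := IH; [by move=> j /ltnW; apply: bO|by move=> j /ltnW; apply: cO|].
pose ap t := (c p t - \sum_(i < p) a i t * b (p - i)%N t) / b 0%N t.
exists (fun j t => if j == p then ap t else a j t); split=> [j|j t].
  rewrite ltnS leq_eqVlt; case: eqVneq => [_ _|_]; last exact: aO.
  apply: OhMl (OhV b0); apply: OhB; first exact: cO.
  apply: Oh_sum => i _; apply: OhMl; first exact: aO.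
  by apply: bO; rewrite ltnS leq_subr.
rewrite ltnS leq_eqVlt => /predU1P[->|jp].
  rewrite /cauchy_prod big_ord_recr/= eqxx subnn /ap divfK//.
  rewrite (eq_bigr (fun i : 'I_p => a i t * b (p - i)%N t)); first by ring.
  by move=> i _; rewrite ltn_eqF.
rewrite -ac//; apply: eq_bigr => i _.
by rewrite ltn_eqF// (leq_ltn_trans _ jp)// -ltnS.
Qed.

Lemma expands_away p f c : expands p.+1 f c -> away (c 0%N) -> away f.
Proof.
move=> Hf /away_perturb; apply.
have [_] := expands_le (isT : (1 <= p.+1)%N) Hf.
by apply: eq_Oh => t; rewrite big_ord1 expr0 mulr1.
Qed.

End Asymptotics.

(** * Taylor's formula and primitives on a closed interval *)

Section Interval.
Context {R : realType} (a b : R).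
Implicit Types (f : R -> R) (g : nat -> R -> R).

Definition taylor_poly p g (x : R) : {poly R} :=
  \sum_(j < p) (g j x / (j`!)%:R) *: ('X - x%:P) ^+ j.

Lemma deriv_taylor_poly p g x :
  (taylor_poly p.+1 g x)^`() = taylor_poly p (fun j => g j.+1) x.
Proof.
rewrite /taylor_poly raddf_sum/= big_ord_recl expr0 derivZ derivC scaler0 add0r.
apply: eq_bigr => i _; rewrite lift0 derivZ deriv_exp derivXsubC mul1r.
rewrite -scalerMnr scalerMnl -mulr_natr -mulrA; congr (_ * _ *: _).
by rewrite factS natrM invfM mulrAC mulVf ?mul1r// pnatr_eq0.
Qed.

Lemma horner_taylor_poly p g x y :
  (taylor_poly p g x).[y] = \sum_(j < p) g j x / (j`!)%:R * (y - x) ^+ j.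
Proof. by rewrite horner_sum; apply: eq_bigr => j _; rewrite !hornerE. Qed.

(** The derivative is bounded only at points no farther from x than y is, because
in [taylor_bound] it is a remainder that grows with the distance to x. *)
Lemma increment_bound (r r' : R -> R) (K x y : R) :
  x \in `[a, b] -> y \in `[a, b] -> {within `[a, b], continuous r} ->
  (forall t, t \in `]a, b[ -> is_derive t 1 r (r' t)) ->
  (forall t, t \in `[a, b] -> `|t - x| <= `|y - x| -> `|r' t| <= K) ->
  `|r y - r x| <= K * `|y - x|.
Proof.
rewrite !in_itv/= => /andP[ax xb] /andP[ay yb] rc rd rK.
have mvt u v : a <= u -> v <= b -> u <= v ->
    exists2 c, c \in `[u, v] & r v - r u = r' c * (v - u).
  move=> au vb uv.
  have ruv : {within `[u, v], continuous r}.
    by apply: continuous_subspaceW rc; apply: subset_itv; rewrite bnd_simp.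
  have duv t : t \in `]u, v[ -> is_derive t 1 r (r' t).
    rewrite in_itv/= => /andP[ut tv]; apply: rd.
    by rewrite in_itv/= (le_lt_trans au ut) (lt_le_trans tv vb).
  by have := @MVT_segment R r r' u v uv; move=> /(_ duv) /(_ ruv).
have [xy|/ltW yx] := leP x y.
  have [c] := mvt _ _ ax yb xy; rewrite in_itv/= => /andP[xc cy] ->.
  rewrite normrM ler_wpM2r// rK//.
    by rewrite in_itv/= (le_trans ax xc) (le_trans cy yb).
  by rewrite !ger0_norm ?subr_ge0// lerD2r.
have [c] := mvt _ _ ay xb yx; rewrite in_itv/= => /andP[yc cx].
rewrite distrC => ->; rewrite normrM (distrC x) ler_wpM2r// rK//.
  by rewrite in_itv/= (le_trans ay yc) (le_trans cx xb).
by rewrite !ler0_norm ?subr_le0// lerN2 lerD2r.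
Qed.

(** Induction on the order: the remainder vanishes at x, and its derivative is the
remainder of one order less for the derivative of g 0, so the mean value theorem
gains a factor y - x. *)
Lemma taylor_bound (M : R) p g x y : x \in `[a, b] -> y \in `[a, b] ->
  (forall j, (j < p)%N -> {within `[a, b], continuous (g j)}) ->
  (forall j t, (j < p)%N -> t \in `]a, b[ -> is_derive t 1 (g j) (g j.+1 t)) ->
  (forall t, t \in `[a, b] -> `|g p t| <= M) ->
  `|g 0%N y - (taylor_poly p g x).[y]| <= M * `|y - x| ^+ p.
Proof.
move=> xab; elim: p g y => [|p IH] g y yab gc gd gM.
  by rewrite /taylor_poly big_ord0 horner0 subr0 expr0 mulr1; exact: gM.
pose r := g 0%N - horner (taylor_poly p.+1 g x).
pose r' t := g 1%N t - (taylor_poly p (fun j => g j.+1) x).[t].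
have rd t : t \in `]a, b[ -> is_derive t 1 r (r' t).
  move=> tab; have := gd 0%N t isT tab => Hd.
  by apply: is_derive_eq; rewrite deriv_taylor_poly.
have rc : {within `[a, b], continuous r}.
  move=> t; have Hc : {within `[a, b], continuous (horner (taylor_poly p.+1 g x))}.
    by apply: continuous_subspaceT; exact: continuous_horner.
  exact: (@continuousB R R^o _ _ _ t (gc 0%N isT t) (Hc t)).
have rx : r x = 0.
  change (g 0%N x - (taylor_poly p.+1 g x).[x] = 0).
  rewrite horner_taylor_poly big_ord_recl big1 => [|i _].
    by rewrite /= expr0 fact0 divr1 mulr1 addr0 subrr.
  by rewrite subrr expr0n/= mulr0.
have r'M t : t \in `[a, b] -> `|r' t| <= M * `|t - x| ^+ p.
  move=> tab; apply: (IH (fun j => g j.+1)) => // j; first by move=> jp; exact: gc.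
  by move=> ? jp; exact: gd.
have M0 : 0 <= M by rewrite (le_trans _ (gM x xab)).
have -> : g 0%N y - (taylor_poly p.+1 g x).[y] = r y - r x by rewrite rx subr0.
rewrite exprSr mulrA; apply: (increment_bound xab yab rc rd) => t tab txy.
by rewrite (le_trans (r'M t tab))// ler_wpM2l// lerXn2r ?nnegrE.
Qed.

(** An average of f becomes a difference quotient of F, so that Taylor's formula
for F describes it. *)
Lemma primitive_itv f : {within `[a, b], continuous f} -> a < b ->
  exists F, [/\ {within `[a, b], continuous F},
    forall t, t \in `]a, b[ -> is_derive t 1 F (f t) &
    forall u v, a <= u -> u <= v -> v <= b ->
      \int[lebesgue_measure]_(t in `[u, v]) f t = F v - F u].
Proof.
move=> fc ab; exists (fun t => parameterized_integral lebesgue_measure a t f).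
have fi := continuous_compact_integrable (@segment_compact R a b) fc.
split=> [|t|u v au uv vb].
- exact: parameterized_integral_continuous (ltW ab) fi.
- rewrite in_itv/= => /andP[at_ tb].
  have tab : t \in `]a, b[ by rewrite in_itv/= at_.
  have [|dF FE] := continuous_FTC1 tb fi _ (within_continuous_continuous ab fc tab).
    by rewrite /= lte_fin.
  by rewrite derive1E in FE; exact: (DeriveDef dF FE).
- rewrite /parameterized_integral Rintegral_itvB ?bnd_simp//.
    rewrite Rintegral_itv_obnd_cbnd//.
    apply: integrableS fi => //.
    by apply: subset_itv; rewrite bnd_simp.
  by apply: integrableS fi => //; apply: subset_itv; rewrite bnd_simp.
Qed.

End Interval.

(** * Partial derivatives relative to a set *)

Section PartialDerivatives.
Context {R : realType} {n : nat} (k : 'I_n).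
Implicit Types (A B : set 'rV[R]_n) (f g : 'rV[R]_n -> R) (x : 'rV[R]_n).

Lemma set_coord_addZ x (t s : R) :
  set_coord x k t + s *: evec R k = set_coord x k (t + s).
Proof.
apply/rowP => l; rewrite !mxE eqxx /=; case: eqP => _; first by rewrite mulr1.
by rewrite mulr0 addr0.
Qed.

Lemma set_coord_id x : set_coord x k (x 0 k) = x.
Proof. by apply/rowP => l; rewrite !mxE; case: eqP => // ->. Qed.

Lemma continuous_set_coord x : continuous (set_coord x k).
Proof.
have E : set_coord x k = (fun t => x + (t - x 0 k) *: evec R k).
  by apply/funext => t; rewrite -{2}[x]set_coord_id set_coord_addZ addrC subrK.
rewrite E => t; apply: cvgD; first exact: cvg_cst.
by apply: cvgZr_tmp; apply: cvgB; [exact: cvg_id|exact: cvg_cst].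
Qed.

#[local] Instance increments_filter A x : Filter (increments A k x).
Proof. exact: within_filter. Qed.

Lemma pderiv_val A f x (l : R) : ProperFilter (increments A k x) ->
  diff_quotient k f x @ increments A k x --> l -> pderiv A k f x = l.
Proof. by move=> FF; apply: cvg_lim. Qed.

(** The increments allowed in the smaller set form a finer filter, along which the
limit persists; a proper filter has no other limit. *)
Lemma pderiv_subset A B f g x : A `<=` B -> (forall y, A y -> f y = g y) -> A x ->
  ProperFilter (increments A k x) -> pderivable B k f x ->
  pderiv A k g x = pderiv B k f x.
Proof.
move=> AB fg Ax FF fB; apply: pderiv_val => P /fB HP.
have {}HP : \forall t \near 0^', B (x + t *: evec R k) -> P (diff_quotient k f x t) by exact: HP.
change (\forall t \near 0^', A (x + t *: evec R k) -> P (diff_quotient k g x t)).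
apply: filterS HP => t HP At.
by rewrite /diff_quotient -!fg//; apply/HP/AB.
Qed.

(** Hence the Taylor coefficients of sigma at a point of the domain do not depend
on whether sigma is considered on the domain or on its extension. *)
Lemma iter_pderiv_subset m A B f : A `<=` B ->
  (forall x, A x -> ProperFilter (increments A k x)) -> smooth_in m B k f ->
  forall j x, (j <= m)%N -> A x ->
    iter j (pderiv A k) f x = iter j (pderiv B k) f x.
Proof.
move=> AB FF [fd _]; elim=> [//|j IH] x jm Ax /=.
apply: pderiv_subset => //; last by apply: fd => //; exact: AB.
  by move=> y Ay; rewrite IH// ltnW.
exact: FF.
Qed.

Lemma cvg_translate A f x : pderivable A k f x ->
  f (x + t *: evec R k) @[t --> increments A k x] --> f x.
Proof.
move=> fd.
have t0 : t @[t --> increments A k x] --> (0 : R).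
  by apply: cvg_within_filter; exact: nbhs_dnbhs.
have := cvgD (cvgM t0 fd) (cvg_cst (f x)).
rewrite mul0r add0r => H.
have FF := increments_filter A x.
have {}H := H FF FF FF.
refine (cvg_trans (near_eq_cvg _) H).
have : \forall t \near increments A k x, t != 0.
  change (\forall t \near 0^', A (x + t *: evec R k) -> t != 0).
  by apply: filterS (nbhs_dnbhs_neq (0 : R)).
apply: filterS => t t0'.
change (t * diff_quotient k f x t + f x = f (x + t *: evec R k)).
by rewrite /diff_quotient mulrA divff// mul1r subrK.
Qed.

(** The neighbours of an inner node may lie on the boundary, so the quotient rule
is needed for one-sided derivatives as well. *)
Lemma pderiv_quotient A f g x : ProperFilter (increments A k x) ->
  f x != 0 -> pderivable A k f x -> pderivable A k g x ->
  pderiv A k (fun y => (f y)^-1 * g y) x =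
  (pderiv A k g x * f x - g x * pderiv A k f x) / f x ^+ 2.
Proof.
move=> FF f0 fd gd; apply: pderiv_val.
have fc := cvg_translate fd.
have lim := cvgM (cvgB (cvgM gd (cvg_cst (f x))) (cvgM (cvg_cst (g x)) fd))
  (cvgV _ (cvgM (cvg_cst (f x)) fc)).
have FF' := increments_filter A x.
move: lim; do !move/(_ FF'); move/(_ (mulf_neq0 f0 f0)); do !move/(_ FF').
move=> lim.
have fn0 : \forall t \near increments A k x, f (x + t *: evec R k) != 0.
  exact: (cvgr_neq0 _ fc f0).
rewrite expr2; refine (cvg_trans (near_eq_cvg _) lim).
apply: filterS fn0 => t ft0.
change ((diff_quotient k g x t * f x - g x * diff_quotient k f x t) /
  (f x * f (x + t *: evec R k)) = t^-1 * ((f (x + t *: evec R k))^-1 *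
   g (x + t *: evec R k) - (f x)^-1 * g x)).
(* The identity holds for every value of the factor 1/t. *)
rewrite /diff_quotient; generalize (t^-1) => s; field.
by rewrite f0.
Qed.

End PartialDerivatives.

(** * Smooth functions on boxes *)

(** Both the closed domain and its extension in one direction are of this form
[cboxE, ext_cboxE]. *)
Definition box {R : realType} {n : nat} (lo hi : 'rV[R]_n) : set 'rV[R]_n :=
  [set x | forall l, lo 0 l <= x 0 l <= hi 0 l].

Section Boxes.
Context {R : realType} {n : nat} (k : 'I_n) (lo hi : 'rV[R]_n).
Implicit Types (f : 'rV[R]_n -> R) (x : 'rV[R]_n).

Local Notation Box := (box lo hi).

Lemma box_set_coord x t : Box x -> lo 0 k <= t <= hi 0 k -> Box (set_coord x k t).
Proof. by move=> Bx tk l; rewrite mxE; case: eqP => [->|_]; [|exact: Bx]. Qed.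

Lemma box_bounded f : {within Box, continuous f} ->
  exists M, forall x, Box x -> `|f x| <= M.
Proof.
move=> fc; have Bc : compact Box.
  have := @rV_compact R n (fun l => `[lo 0 l, hi 0 l]%classic) (fun l => @segment_compact _ _ _).
  by congr compact; apply/seteqP; split=> x /= Bx l; have := Bx l; rewrite in_itv.
have [M [_ HM]] := compact_bounded (continuous_compact fc Bc).
exists (M + 1) => x Bx; apply: (HM (M + 1)); first by rewrite ltrDl.
by exists x.
Qed.

(** On a face of the box only the increments pointing inwards remain. *)
Lemma increments_proper x : lo 0 k < hi 0 k -> Box x ->
  ProperFilter (increments Box k x).
Proof.
move=> lohi Bx; apply: Build_ProperFilter_ex => P [e /= e0 HP].
have /andP[lox xhi] := Bx k.
have Bt t : lo 0 k <= x 0 k + t <= hi 0 k -> Box (x + t *: evec R k).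
  by rewrite -{3}(set_coord_id k x) set_coord_addZ; exact: box_set_coord.
have [xh|hx] := ltP (x 0 k) (hi 0 k).
  pose t := Order.min (e / 2) (hi 0 k - x 0 k).
  have t0 : 0 < t by rewrite lt_min divr_gt0//= subr_gt0.
  have te : t < e by rewrite gt_min; apply/orP; left; lra.
  have th : t <= hi 0 k - x 0 k by rewrite ge_min lexx orbT.
  exists t; apply: HP => /=; first by rewrite sub0r normrN gtr0_norm.
    by rewrite gt_eqF.
  by apply: Bt; apply/andP; split; lra.
pose t := Order.min (e / 2) (x 0 k - lo 0 k).
have t0 : 0 < t by rewrite lt_min divr_gt0//= subr_gt0 (lt_le_trans lohi).
have te : t < e by rewrite gt_min; apply/orP; left; lra.
have th : t <= x 0 k - lo 0 k by rewrite ge_min lexx orbT.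
exists (- t); apply: HP => /=; first by rewrite sub0r opprK gtr0_norm.
  by rewrite oppr_eq0 gt_eqF.
by apply: Bt; apply/andP; split; lra.
Qed.

Lemma continuous_line f x : Box x -> {within Box, continuous f} ->
  {within `[lo 0 k, hi 0 k], continuous (fun t => f (set_coord x k t))}.
Proof.
move=> Bx /subspace_continuousP fc; apply/subspace_continuousP => t tk.
have Bt : Box (set_coord x k t) by apply: box_set_coord => //; move: tk; rewrite /= in_itv.
move=> P /(fc _ Bt) HP.
have HP' : \forall y \near nbhs (set_coord x k t), Box y -> P (f y) by exact: HP.
have := continuous_set_coord HP'.
change ((\forall s \near t, Box (set_coord x k s) -> P (f (set_coord x k s))) ->
  \forall s \near t, `[lo 0 k, hi 0 k]%classic s -> P (f (set_coord x k s))).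
apply: filterS => s H sk; apply: H; apply: box_set_coord => //.
Qed.

Lemma is_derive_line f x t : Box x -> t \in `]lo 0 k, hi 0 k[ ->
  pderivable Box k f (set_coord x k t) ->
  is_derive t 1 (fun t => f (set_coord x k t)) (pderiv Box k f (set_coord x k t)).
Proof.
rewrite in_itv/= => Bx /andP[lot thi] fd.
have near0 : \forall s \near (0 : R)^', Box (set_coord x k t + s *: evec R k).
  have e0 : 0 < Order.min (t - lo 0 k) (hi 0 k - t) by rewrite lt_min !subr_gt0 lot.
  exists (Order.min (t - lo 0 k) (hi 0 k - t)) => //= s.
  rewrite /ball_ /= sub0r normrN lt_min => /andP[s1 s2] _; rewrite set_coord_addZ.
  apply: box_set_coord => //; have := ler_norm s; have := ler_norm (- s).
  by rewrite normrN => ? ?; apply/andP; split; lra.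
have H : diff_quotient k f (set_coord x k t) @ 0^' --> pderiv Box k f (set_coord x k t).
  move=> P /fd HP.
  have HP' : \forall s \near (0 : R)^', Box (set_coord x k t + s *: evec R k) ->
    P (diff_quotient k f (set_coord x k t) s) by exact: HP.
  change (\forall s \near 0^', P (diff_quotient k f (set_coord x k t) s)).
  by apply: filterS2 near0 HP' => s Bs; apply.
have E : (fun s : R => s^-1 *: (((fun t => f (set_coord x k t)) \o shift t) (s *: 1)
    - f (set_coord x k t))) = diff_quotient k f (set_coord x k t).
  apply/funext => s; rewrite /diff_quotient set_coord_addZ /=.
  by rewrite [s *: 1]mulr1 [s + t]addrC.
have D : derivable (fun t => f (set_coord x k t)) t 1.
  by apply/cvg_ex; exists (pderiv Box k f (set_coord x k t)); rewrite E.
apply: DeriveDef D _.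
by rewrite /derive; apply: cvg_lim => //; rewrite E.
Qed.

Definition taylor_coef f j x : R := iter j (pderiv Box k) f x / (j`!)%:R.

Lemma line_taylor p f : smooth_in p Box k f -> exists M, forall x s, Box x ->
  lo 0 k <= s <= hi 0 k ->
  `| f (set_coord x k s) - \sum_(j < p) taylor_coef f j x * (s - x 0 k) ^+ j |
  <= M * `|s - x 0 k| ^+ p.
Proof.
move=> [fd fc]; have [M HM] := box_bounded (fc p (leqnn p)); exists M => x s Bx sk.
pose g j t := iter j (pderiv Box k) f (set_coord x k t).
have := @taylor_bound R (lo 0 k) (hi 0 k) M p g (x 0 k) s.
rewrite horner_taylor_poly /g set_coord_id; apply.
- by rewrite in_itv/=; exact: Bx.
- by rewrite in_itv.
- by move=> j jp; apply: continuous_line => //; apply: fc; exact: ltnW.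
- move=> j t jp tk; apply: is_derive_line => //; apply: fd => //.
  by apply: box_set_coord => //; move: tk; rewrite in_itv/= => /andP[/ltW-> /ltW->].
- by move=> t tk; apply/HM/box_set_coord => //; move: tk; rewrite in_itv.
Qed.

(** This is Taylor's formula for a primitive of f along the line, with the
coefficients of f shifted by one. *)
Lemma line_integral_taylor p f : lo 0 k < hi 0 k -> smooth_in p Box k f ->
  exists M, forall x u v, Box x -> lo 0 k <= u -> u <= v -> v <= hi 0 k ->
  `| \int[lebesgue_measure]_(t in `[u, v]) f (set_coord x k t)
     - \sum_(j < p) taylor_coef f j x *
         (((v - x 0 k) ^+ j.+1 - (u - x 0 k) ^+ j.+1) / j.+1%:R) |
  <= M * (`|v - x 0 k| ^+ p.+1 + `|u - x 0 k| ^+ p.+1).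
Proof.
move=> lohi [fd fc]; have [M HM] := box_bounded (fc p (leqnn p)).
exists M => x u v Bx au uv vb.
have lc : {within `[lo 0 k, hi 0 k], continuous (fun t => f (set_coord x k t))}.
  exact/continuous_line/(fc 0%N).
have [F [Fc Fd FE]] := primitive_itv lc lohi.
pose g j t := if j is j'.+1 then iter j' (pderiv Box k) f (set_coord x k t) else F t.
have bound s : lo 0 k <= s <= hi 0 k ->
    `|F s - (taylor_poly p.+1 g (x 0 k)).[s]| <= M * `|s - x 0 k| ^+ p.+1.
  move=> sk; apply: (@taylor_bound R (lo 0 k) (hi 0 k) M p.+1 g (x 0 k) s).
  - by rewrite in_itv/=; exact: Bx.
  - by rewrite in_itv.
  - by case=> [_|j jp]; [exact: Fc|apply: continuous_line => //; apply: fc; exact: ltnW].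
  - case=> [t _ tk|j t jp tk]; first exact: Fd.
    apply: is_derive_line => //; apply: fd => //.
    by apply: box_set_coord => //; move: tk; rewrite in_itv/= => /andP[/ltW-> /ltW->].
  - by move=> t tk; apply/HM/box_set_coord => //; move: tk; rewrite in_itv.
have vk : lo 0 k <= v <= hi 0 k by rewrite vb (le_trans au uv).
have uk : lo 0 k <= u <= hi 0 k by rewrite au (le_trans uv vb).
rewrite mulrDr; apply: le_trans (lerD (bound v vk) (bound u uk)).
apply: le_trans (ler_normB _ _); rewrite FE// le_eqVlt; apply/orP; left.
apply/eqP; congr (`|_|); rewrite !horner_taylor_poly !big_ord_recl !expr0 /=.
set S := \sum_(j < p) taylor_coef f j x * _.
set Sv := \sum_(j < p) _; set Su := \sum_(j < p) _.
suff -> : S = Sv - Su by ring.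
rewrite /S /Sv /Su -sumrB; apply: eq_bigr => j _.
rewrite /g /taylor_coef set_coord_id /bump/= add1n factS natrM invfM.
ring.
Qed.

End Boxes.

(** * Expansions of sampled functions *)

Section SmoothDerivatives.
Context {R : realType} {n : nat} (k : 'I_n).

Lemma smooth_in_le p q (A : set 'rV[R]_n) f : (p <= q)%N ->
  smooth_in q A k f -> smooth_in p A k f.
Proof.
move=> pq [fd fc]; split=> j jp; first by apply: fd; exact: leq_trans pq.
by apply: fc; exact: leq_trans pq.
Qed.

Lemma smooth_in_pderiv p (A : set 'rV[R]_n) f :
  smooth_in p.+1 A k f -> smooth_in p A k (pderiv A k f).
Proof. by move=> [fd fc]; split=> j jp; rewrite -iterSr; [exact: fd|exact: fc]. Qed.

Lemma taylor_coef0 (lo hi : 'rV[R]_n) f x : taylor_coef k lo hi f 0 x = f x.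
Proof. by rewrite /taylor_coef fact0 divr1. Qed.

Lemma taylor_coef_pderiv (lo hi : 'rV[R]_n) f j x :
  taylor_coef k lo hi (pderiv (box lo hi) k f) j x = j.+1%:R * taylor_coef k lo hi f j.+1 x.
Proof.
by rewrite /taylor_coef -iterSr factS natrM invfM mulrCA (mulrA j.+1%:R) divff ?mul1r//.
Qed.

End SmoothDerivatives.

Section Sampling.
Context {R : realType} {n : nat} (k : 'I_n) (lo hi : 'rV[R]_n).
Context (lohi : lo 0 k < hi 0 k).
Context {T : Type} (h : T -> R) (h_gt0 : forall t, 0 < h t).
Context (x : T -> 'rV[R]_n) (xbox : forall t, box lo hi (x t)).
Implicit Types (f : 'rV[R]_n -> R) (p : nat).

Local Notation tc f j t := (taylor_coef k lo hi f j (x t)).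

Lemma Oh_taylor_coef p f j : (j <= p)%N -> smooth_in p (box lo hi) k f ->
  Oh h 0 (fun t => tc f j t).
Proof.
move=> jp [_ fc]; have [M HM] := box_bounded (fc j jp).
apply: (@Oh_bound _ _ h _ _ (M / (j`!)%:R)) => t.
by rewrite expr0 mulr1 normrM [X in _ * X]ger0_norm// ler_wpM2r// HM.
Qed.

Lemma expands_point (e : R) p f : smooth_in p (box lo hi) k f ->
  (forall t, lo 0 k <= x t 0 k + e * h t <= hi 0 k) ->
  expands h p (fun t => f (set_coord (x t) k (x t 0 k + e * h t)))
    (fun j t => e ^+ j * tc f j t).
Proof.
move=> fs xe; split=> [j jp|].
  by apply: OhMl; [exact: Oh_cst|apply: Oh_taylor_coef fs; exact: ltnW].
have [M HM] := line_taylor fs.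
apply: (@Oh_bound _ _ _ _ _ (M * `|e| ^+ p)) => t.
have := HM _ _ (xbox t) (xe t); rewrite addrAC subrr add0r normrM exprMn.
rewrite (gtr0_norm (h_gt0 t)) mulrA; congr (`|_ - _| <= _).
by apply: eq_bigr => j _; rewrite exprMn; ring.
Qed.

Lemma expands_average (a b : R) p f : smooth_in p (box lo hi) k f -> a <= b ->
  (forall t, lo 0 k <= x t 0 k + a * h t) ->
  (forall t, x t 0 k + b * h t <= hi 0 k) ->
  expands h p (fun t => (h t)^-1 * \int[lebesgue_measure]_(s in
      `[x t 0 k + a * h t, x t 0 k + b * h t]) f (set_coord (x t) k s))
    (fun j t => (b ^+ j.+1 - a ^+ j.+1) / j.+1%:R * tc f j t).
Proof.
move=> fs ab xa xb; split=> [j jp|].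
  by apply: OhMl; [exact: Oh_cst|apply: Oh_taylor_coef fs; exact: ltnW].
have [M HM] := line_integral_taylor lohi fs.
apply: (@Oh_bound _ _ _ _ _ (M * (`|b| ^+ p.+1 + `|a| ^+ p.+1))) => t.
have hab : x t 0 k + a * h t <= x t 0 k + b * h t by rewrite lerD2l ler_pM2r.
have := HM _ _ _ (xbox t) (xa t) hab (xb t).
have e0 (c : R) : x t 0 k + c * h t - x t 0 k = c * h t by ring.
rewrite !e0 !normrM (gtr0_norm (h_gt0 t)) !exprMn -mulrDl mulrA.
rewrite [h t ^+ p.+1]exprSr [_ * (h t ^+ p * h t)]mulrA -ler_pdivrMr//.
apply: le_trans; rewrite ler_pdivlMr// -[X in `|_| * X](gtr0_norm (h_gt0 t)) -normrM.
rewrite le_eqVlt; apply/orP; left; apply/eqP; congr (`|_|).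
have h0 : h t != 0 by rewrite gt_eqF.
rewrite mulrBl mulrAC mulVf// mul1r; congr (_ - _).
rewrite mulr_suml; apply: eq_bigr => j _; rewrite !exprMn -mulrBl [h t ^+ j.+1]exprSr.
ring.
Qed.

End Sampling.

(** * Mean values of the coefficient *)

Section Nodes.
Context {R : realType} {n : nat} (k : 'I_n).
Implicit Types (h : 'rV[R]_n) (i : 'rV[int]_n) (e : int).

Lemma set_coord_set_coord (x : 'rV[R]_n) s t :
  set_coord (set_coord x k s) k t = set_coord x k t.
Proof. by apply/rowP => l; rewrite !mxE; case: eqP. Qed.

Lemma node_shift h i e : node h (i + e *: evec int k) =
  set_coord (node h i) k (node h i 0 k + e%:~R * h 0 k).
Proof.
apply/rowP => l; rewrite !mxE eqxx /=; case: eqP => [->|_].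
  by rewrite mulr1 rmorphD/= mulrDl.
by rewrite mulr0 addr0.
Qed.

(** The result of the mean rule for the function s^j on the cell [e - 1, e] of
unit length. *)
Definition moment (r : mean_rule) (e : R) (j : nat) : R :=
  match r with
  | IntegralMean => (e ^+ j.+1 - (e - 1) ^+ j.+1) / j.+1%:R
  | SimpsonMean => ((e - 1) ^+ j + 4 * (e - 1 / 2) ^+ j + e ^+ j) / 6
  | GaussMean => ((e - 1 / 2 - thetaG) ^+ j + (e - 1 / 2 + thetaG) ^+ j) / 2
  end.

Lemma thetaG_sqr : (thetaG : R) ^+ 2 = 1 / 12.
Proof.
rewrite /thetaG expr_div_n exprMn sqr_sqrtr ?ler0n// expr1n.
by congr (1 / _); ring.
Qed.

Lemma thetaG_bounds : 0 <= (thetaG : R) <= 1 / 2.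
Proof.
have t0 : 0 <= (thetaG : R) by rewrite divr_ge0// mulr_ge0// sqrtr_ge0.
have := thetaG_sqr; rewrite t0 /=; nra.
Qed.

(** Simpson's rule and the two-point Gauss rule are exact for cubics. *)
Lemma moment_exact r (e : R) j : (j <= 3)%N ->
  moment r e j = (e ^+ j.+1 - (e - 1) ^+ j.+1) / j.+1%:R.
Proof.
have t2 := thetaG_sqr.
case: r => //; case: j => [|[|[|[|//]]]] _ /=; try by field.
- rewrite -[(_ + _) / 2]/(((e - 1 / 2 - thetaG) ^+ 2 + (e - 1 / 2 + thetaG) ^+ 2) / 2).
  have -> : (e - 1 / 2 - thetaG) ^+ 2 + (e - 1 / 2 + thetaG) ^+ 2 =
    2 * (e - 1 / 2) ^+ 2 + 2 * thetaG ^+ 2 by ring.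
  by rewrite t2; field.
- have -> : (e - 1 / 2 - thetaG) ^+ 3 + (e - 1 / 2 + thetaG) ^+ 3 =
    2 * (e - 1 / 2) ^+ 3 + 6 * (e - 1 / 2) * thetaG ^+ 2 by ring.
  by rewrite t2; field.
Qed.

(** The rules are symmetric about the midpoint, and the cells [-1, 0] and [0, 1]
are mirror images of each other in the node between them. *)
Lemma moment4_adjacent r : moment r 0 4 = moment r 1 4.
Proof. by case: r; rewrite /moment; field. Qed.

End Nodes.

Section Means.
Context {R : realType} {n : nat} (k : 'I_n) (lo hi : 'rV[R]_n).
Context (lohi : lo 0 k < hi 0 k).
Context {T : Type} (step : T -> 'rV[R]_n) (idx : T -> 'rV[int]_n).
Context (step_gt0 : forall t, 0 < step t 0 k).
Context (in_box : forall t, box lo hi (node (step t) (idx t))).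

Local Notation h := (fun t => step t 0 k).
Local Notation x t := (node (step t) (idx t)).
Local Notation tc f j t := (taylor_coef k lo hi f j (x t)).

Lemma expands_node (e : int) p f : smooth_in p (box lo hi) k f ->
  (forall t, lo 0 k <= x t 0 k + e%:~R * h t <= hi 0 k) ->
  expands h p (fun t => f (node (step t) (idx t + e *: evec int k)))
    (fun j t => e%:~R ^+ j * tc f j t).
Proof.
move=> fs xe; have := expands_point step_gt0 in_box fs xe.
by apply: eq_expands => //; apply: nearW => t; rewrite node_shift.
Qed.

Lemma expands_mean r (e : int) p f : smooth_in p (box lo hi) k f ->
  (forall t, lo 0 k <= x t 0 k + (e%:~R - 1) * h t) ->
  (forall t, x t 0 k + e%:~R * h t <= hi 0 k) ->
  expands h p (fun t => mean r (step t) k f (idx t + e *: evec int k))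
    (fun j t => moment r e%:~R j * tc f j t).
Proof.
move=> fs xlo xhi.
have pt (c : R) : e%:~R - 1 <= c <= e%:~R ->
    expands h p (fun t => f (set_coord (x t) k (x t 0 k + c * h t)))
      (fun j t => c ^+ j * tc f j t).
  move=> /andP[c1 c2]; apply: expands_point => // t.
  apply/andP; split.
    by apply: le_trans (xlo t) _; rewrite lerD2l ler_wpM2r// ltW.
  by apply: le_trans (xhi t); rewrite lerD2l ler_wpM2r// ltW.
have addZ t (s c : R) : e%:~R * h t + s = c * h t ->
    node (step t) (idx t + e *: evec int k) + s *: evec R k =
    set_coord (x t) k (x t 0 k + c * h t).
  by move=> <-; rewrite node_shift set_coord_addZ addrA.
have /andP[th0 th1] := @thetaG_bounds R.
pose E : R := e%:~R.
case: r => /=.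
- have := expands_average lohi step_gt0 in_box fs _ xlo xhi.
  have le1 : e%:~R - 1 <= (e%:~R : R) by rewrite gerBl.
  move=> /(_ le1); apply: eq_expands => //; apply: nearW => t; congr (_ * _).
  have xE (c : R) : x t 0 k + c * h t = ((idx t 0 k)%:~R + c) * h t.
    by rewrite mxE mulrDl.
  have K : (idx t + e *: evec int k) 0 k = idx t 0 k + e.
    by rewrite !mxE !eqxx mulr1.
  rewrite !xE K rmorphD/= addrA; apply: eq_Rintegral => s _.
  by rewrite node_shift set_coord_set_coord.
- have b1 : E - 1 <= E - 1 <= E by apply/andP; split; lra.
  have b2 : E - 1 <= E - 1 / 2 <= E by apply/andP; split; lra.
  have b3 : E - 1 <= E <= E by apply/andP; split; lra.
  have := expandsZ (Oh_cst h 6^-1) (expandsD (expandsD (pt _ b1)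
    (expandsZ (Oh_cst h 4) (pt _ b2))) (pt _ b3)).
  apply: eq_expands => [|j t _]; last by field.
  apply: nearW => t; rewrite -scaleNr (addZ _ _ (E - 1 / 2)); last by field.
  have -> : idx t + e *: evec int k - evec int k = idx t + (e - 1) *: evec int k.
    by rewrite scalerBl scale1r addrA.
  by rewrite !node_shift rmorphB/=; field.
- have b1 : E - 1 <= E - 1 / 2 - thetaG <= E.
    by apply/andP; split; lra.
  have b2 : E - 1 <= E - 1 / 2 + thetaG <= E.
    by apply/andP; split; lra.
  have := expandsZ (Oh_cst h 2^-1) (expandsD (pt _ b1) (pt _ b2)).
  apply: eq_expands => [|j t _]; last by field.
  apply: nearW => t; rewrite -addrA -addrA -!(scaleNr _ (evec R k)) -!(scalerDl (evec R k)).
  rewrite (addZ _ _ (E - 1 / 2 - thetaG)); last by rewrite /E; field.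
  rewrite (addZ _ _ (E - 1 / 2 + thetaG)); last by rewrite /E; field.
  by field.
Qed.

End Means.

(** * Identities between the coefficients *)

Section Algebra.
Context {R : realType} {T : Type} (h : T -> R) (h_gt0 : forall t, 0 < h t).
Implicit Types (s w u : nat -> T -> R) (e : R).

(** Without denominators the harmonic mean c of A and B is given by
c (A + B) = 2 A B. *)
Lemma expands_harmonic_mean p (A B : T -> R) a b c :
  away h A -> away h B -> expands h p A a -> expands h p B b ->
  (forall j, (j < p)%N -> Oh h 0 (c j)) ->
  (forall j t, (j < p)%N ->
     cauchy_prod c (fun j t => a j t + b j t) j t = 2 * cauchy_prod a b j t) ->
  expands h p (fun t => (2^-1 * ((A t)^-1 + (B t)^-1))^-1) c.
Proof.
move=> Aa Ba HA HB cO cE.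
apply: (expands_quotient h_gt0 (awayD Aa Ba) _ cO cE (expandsD HA HB)
  (expandsZ (Oh_cst h 2) (expandsM h_gt0 HA HB))).
apply: filterS3 (away_neq0 Aa) (away_neq0 Ba) (away_neq0 (awayD Aa Ba)) => t A0 B0 AB0.
by field; rewrite A0 B0 addrC AB0.
Qed.

(** If s_j are the Taylor coefficients of a function, these are the coefficients
in h of its value at the offset e h. *)
Definition sample s e j (t : T) : R := e ^+ j * s j t.

(** The Taylor coefficients of the derivative. *)
Definition dseries s j (t : T) : R := j.+1%:R * s j.+1 t.

(** The coefficients, up to h^3, of sigma + h^2 a at the offset e h, where a has
the value a0 and the derivative a1 at the node. *)
Definition corrected s (a0 a1 : T -> R) e j (t : T) : R :=
  e ^+ j * s j t + [:: 0; 0; a0 t; e * a1 t]`_j.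

(** The harmonic mean of the two adjacent mean values is sigma + h^2 a + O(h^4)
with a = sigma''/6 - sigma'^2/(4 sigma); this is a in terms of the Taylor
coefficients, and [harmonic_corr1] is its derivative. *)
Definition harmonic_corr0 s t : R := s 2%N t / 3 - s 1%N t ^+ 2 / (4 * s 0%N t).
Definition harmonic_corr1 s t : R :=
  s 3%N t - s 1%N t * s 2%N t / s 0%N t + s 1%N t ^+ 3 / (4 * s 0%N t ^+ 2).

(** With [expands_harmonic_mean], the expansion of the harmonic coefficient at the
offset e h, where the two cells are [e - 1, e] and [e, e + 1]. *)
Lemma cauchy_prod_harmonic r s e j t : s 0%N t != 0 -> (j < 4)%N ->
  cauchy_prod (corrected s (harmonic_corr0 s) (harmonic_corr1 s) e)
    (fun j t => moment r e j * s j t + moment r (e + 1) j * s j t) j t =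
  2 * cauchy_prod (fun j t => moment r e j * s j t) (fun j t => moment r (e + 1) j * s j t) j t.
Proof.
move=> s0; case: j => [|[|[|[|//]]]] _; rewrite /cauchy_prod !big_ord_recr !big_ord0 /=
  ?subSS ?subn0 /corrected /harmonic_corr0 /harmonic_corr1 /= !moment_exact//.
- by field.
- by field.
- by field; rewrite ?s0.
- by field; rewrite ?s0.
Qed.

(** The hypothesis says that u is the series of the flux w'/sigma; the conclusion
is the quotient rule u' sigma^2 = w'' sigma - w' sigma' at the offset e h. It
replaces any computation with higher derivatives of quotients. *)
Lemma cauchy_prod_flux s w u e j t : (j < 4)%N ->
  (forall j t, (j < 5)%N -> cauchy_prod u s j t = dseries w j t) ->
  cauchy_prod (sample (dseries u) e) (cauchy_prod (sample s e) (sample s e)) j t =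
  cauchy_prod (sample (dseries (dseries w)) e) (sample s e) j t
  - cauchy_prod (sample (dseries w) e) (sample (dseries s) e) j t.
Proof.
move=> j4 us.
have wE i : (i < 5)%N -> w i.+1 t = cauchy_prod u s i t / i.+1%:R.
  by move=> /us->; rewrite /dseries mulrAC divff ?mul1r// pnatr_eq0.
case: j j4 => [|[|[|[|//]]]] _; rewrite /cauchy_prod !big_ord_recr !big_ord0 /= ?subSS ?subn0;
rewrite /sample /dseries !wE// /cauchy_prod !big_ord_recr !big_ord0 /= ?subSS ?subn0; by field.
Qed.

(** The letters D, M and V stand for the difference quotients of w,
the mean values of sigma and the values of sigma^(k) L w, at the right, at the left
and at the node. All coefficients vanish for arbitrary s, u, a0, a1: those of
even order because the expression changes sign with h, which exchanges left and
right; that of h because L w = u'; that of h^3 thanks to the factor 1/12. In the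
coefficient of h^4 the fourth moments appear only as the difference of those of
the two cells. *)
Lemma defect_expansion r s w u a0 a1 (Dp Dm Mp Mm L Vp V Vm : T -> R) :
  (forall j t, (j < 5)%N -> cauchy_prod u s j t = dseries w j t) ->
  expands h 5 Dp (fun j t => w j.+1 t) ->
  expands h 5 Dm (fun j t => (-1) ^+ j * w j.+1 t) ->
  expands h 5 Mp (fun j t => moment r 1 j * s j t) ->
  expands h 5 Mm (fun j t => moment r 0 j * s j t) ->
  expands h 4 L (sample (dseries u) 0) ->
  expands h 4 Vp (cauchy_prod (corrected s a0 a1 1) (sample (dseries u) 1)) ->
  expands h 4 V (cauchy_prod (corrected s a0 a1 0) (sample (dseries u) 0)) ->
  expands h 4 Vm (cauchy_prod (corrected s a0 a1 (-1)) (sample (dseries u) (-1))) ->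
  Oh h 5 (fun t => Dp t * Mm t - Dm t * Mp t - h t * (L t * (Mp t * Mm t))
    - h t * (12^-1 * ((Vp t - V t) * Mm t - (V t - Vm t) * Mp t))).
Proof.
move=> us HDp HDm HMp HMm HL HVp HV HVm.
have le45 : (4 <= 5)%N by [].
have HMp4 := expands_le h_gt0 le45 HMp; have HMm4 := expands_le h_gt0 le45 HMm.
have H := expandsB (expandsB (expandsB (expandsM h_gt0 HDp HMm) (expandsM h_gt0 HDm HMp))
  (expands_mulh h_gt0 (expandsM h_gt0 HL (expandsM h_gt0 HMp4 HMm4))))
  (expands_mulh h_gt0 (expandsZ (Oh_cst h 12^-1)
    (expandsB (expandsM h_gt0 (expandsB HVp HV) HMm4)
              (expandsM h_gt0 (expandsB HV HVm) HMp4)))).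
apply: expands_small H => j t j5.
have wE i : (i < 5)%N -> w i.+1 t = cauchy_prod u s i t / i.+1%:R.
  by move=> /us->; rewrite /dseries mulrAC divff ?mul1r// pnatr_eq0.
have m0 e := @moment_exact R r e 0 isT; have m1 e := @moment_exact R r e 1 isT.
have m2 e := @moment_exact R r e 2 isT; have m3 e := @moment_exact R r e 3 isT.
case: j j5 => [|[|[|[|[|//]]]]] _.
all: rewrite /cauchy_prod !big_ord_recr !big_ord0 /= ?subSS ?subn0.
all: rewrite ?moment4_adjacent ?m0 ?m1 ?m2 ?m3 /corrected /sample /dseries.
all: rewrite ?(wE 0%N)// ?(wE 1%N)// ?(wE 2)// ?(wE 3)// ?(wE 4)//.
all: rewrite /cauchy_prod ?big_ord_recr ?big_ord0 /= ?subSS ?subn0.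
all: by field.
Qed.

End Algebra.

(** * Expansions of the mesh functions *)

(** The reciprocal of f is continuous on a compact set, hence bounded. *)
Lemma box_away {R : realType} {n : nat} (lo hi : 'rV[R]_n) (f : 'rV[R]_n -> R) :
  {within box lo hi, continuous f} -> (forall x, box lo hi x -> 0 < f x) ->
  exists2 d, 0 < d & forall x, box lo hi x -> d <= f x.
Proof.
move=> fc f0; have : {within box lo hi, continuous (fun x => (f x)^-1)}.
  apply/subspace_continuousP => x Bx; apply: cvgV; first by rewrite gt_eqF// f0.
  by move/subspace_continuousP: fc; apply.
move=> /box_bounded[M HM]; exists (`|M| + 1)^-1; first by rewrite invr_gt0 ltr_wpDl.
move=> x Bx; have fx := f0 x Bx; rewrite -[f x]invrK lef_pV2 ?posrE ?invr_gt0 ?ltr_wpDl//.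
have := HM x Bx; rewrite gtr0_norm ?invr_gt0// => /le_trans; apply.
by rewrite (le_trans (ler_norm M))// lerDl.
Qed.

Section MeshFunctions.
Context {R : realType} {n : nat} (k : 'I_n) (lo hi : 'rV[R]_n).
Context (lohi : lo 0 k < hi 0 k).
Context {T : Type} (step : T -> 'rV[R]_n) (idx : T -> 'rV[int]_n).
Context (step_gt0 : forall t, 0 < step t 0 k).
Context (in_box : forall t, box lo hi (node (step t) (idx t))).

Local Notation h := (fun t => step t 0 k).
Local Notation x t := (node (step t) (idx t)).
Local Notation tc f := (fun j t => taylor_coef k lo hi f j (x t)).
Local Notation at_ t e := (idx t + e *: evec int k).

Definition reaches (e : int) : Prop :=
  forall t, lo 0 k <= x t 0 k + e%:~R * h t <= hi 0 k.

Lemma node_in_box (e : int) t : reaches e -> box lo hi (node (step t) (at_ t e)).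
Proof. by move=> re; rewrite node_shift; apply: box_set_coord; [exact: in_box|exact: re]. Qed.

(** The leading coefficient of the expansion is the value of f at the node, so a
lower bound for f at the nodes suffices. *)
Lemma away_mean r (e : int) f : smooth_in 1 (box lo hi) k f ->
  away h (fun t => f (x t)) -> reaches (e - 1) -> reaches e ->
  away h (fun t => mean r (step t) k f (at_ t e)).
Proof.
move=> fs fa r1 re.
have := expands_mean lohi step_gt0 in_box r (e := e) fs.
move=> H; apply: (expands_away step_gt0 (H _ _)).
- by move=> t; have /andP[+ _] := r1 t; rewrite rmorphB.
- by move=> t; have /andP[] := re t.
have [d d0 Hd] := fa; exists d => //; apply: filterS Hd => t.
by rewrite moment_exact// taylor_coef0 !expr1 divr1 opprB addrC subrK mul1r.
Qed.

Lemma Oh_harmonic_corr (s : nat -> T -> R) : away h (s 0%N) ->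
  (forall j, (j < 4)%N -> Oh h 0 (s j)) ->
  Oh h 0 (harmonic_corr0 s) /\ Oh h 0 (harmonic_corr1 s).
Proof.
move=> s0 sO; have V := OhV s0.
have s1 := sO 1%N isT; have s2 := sO 2 isT; have s3 := sO 3 isT; split.
  have := OhB (OhMr s2 (Oh_cst h 3^-1))
    (OhMr (OhX 2 s1) (OhMr (Oh_cst h 4^-1) V)).
  by apply: eq_Oh => t; rewrite /harmonic_corr0 invfM.
have := OhD (OhB s3 (OhMr (OhMr s1 s2) V))
   (OhMr (OhX 3 s1) (OhMr (Oh_cst h 4^-1) (OhX 2 V))).
by apply: eq_Oh => t; rewrite /harmonic_corr1 invfM exprVn.
Qed.

(** For every offset e the same functions a0 and a1 serve: to this order the
correction is the sample of one smooth function. *)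
Lemma expands_coef c r f : smooth_in 4 (box lo hi) k f ->
  (forall t, f (x t) != 0) -> away h (fun t => f (x t)) ->
  (forall e : int, `|e| <= (if c is HarmonicCoef then 2 else 1) -> reaches e) ->
  exists a0 a1, forall e : int, `|e| <= 1 ->
    expands h 4 (fun t => coef c r (step t) k f (at_ t e))
      (corrected (tc f) a0 a1 e%:~R).
Proof.
move=> fs f0 fa re.
have sO j : (j < 4)%N -> Oh h 0 (tc f j).
  by move=> j4; apply: Oh_taylor_coef fs => //; exact: ltnW.
case: c re => /= re.
  exists (fun=> 0), (fun=> 0) => e e1.
  have := expands_node step_gt0 in_box fs (re e e1).
  apply: eq_expands => [|j t]; first exact: nearW.
  by rewrite /corrected; case: j => [|[|[|[|//]]]] _; rewrite /= ?mulr0 addr0.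
have tc0 : tc f 0%N = fun t => f (x t) by apply/funext => t; rewrite taylor_coef0.
have [] := @Oh_harmonic_corr (tc f); rewrite ?tc0//.
set a0 := harmonic_corr0 _; set a1 := harmonic_corr1 _ => a0O a1O.
exists a0, a1 => e e1.
have rng (d : int) : `|d| <= 1 -> reaches (e + d).
  by move=> d1; apply: re; lia.
have r0 := rng 0 isT; have r1 := rng 1 isT; have rN1 := rng (-1) isT.
rewrite addr0 in r0.
have fs1 : smooth_in 1 (box lo hi) k f by apply: smooth_in_le fs.
have HA : expands h 4 (fun t => mean r (step t) k f (at_ t e)) _ :=
  expands_mean lohi step_gt0 in_box r fs _ _.
have HB : expands h 4 (fun t => mean r (step t) k f (at_ t (e + 1))) _ :=
  expands_mean lohi step_gt0 in_box r fs _ _.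
have lA t : lo 0 k <= x t 0 k + (e%:~R - 1) * h t.
  by have /andP[+ _] := rN1 t; rewrite rmorphB.
have hA t : x t 0 k + e%:~R * h t <= hi 0 k by have /andP[] := r0 t.
have lB t : lo 0 k <= x t 0 k + ((e + 1)%:~R - 1) * h t.
  by have /andP[+ _] := r0 t; rewrite rmorphD/= addrK.
have hB t : x t 0 k + (e + 1)%:~R * h t <= hi 0 k by have /andP[] := r1 t.
have aA : away h (fun t => mean r (step t) k f (at_ t e)) by apply: away_mean.
have aB : away h (fun t => mean r (step t) k f (at_ t (e + 1))).
  by apply: away_mean; rewrite ?addrK.
have := expands_harmonic_mean step_gt0 aA aB (HA lA hA) (HB lB hB).
move=> /(_ (corrected (tc f) a0 a1 e%:~R)) H.
apply: eq_expands (H _ _) => //.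
- by apply: nearW => t; rewrite /coef scalerDl scale1r addrA.
- move=> j j4; apply: OhD; first by apply: OhMl; [exact: Oh_cst|exact: sO].
  case: j j4 => [|[|[|[|//]]]] _; [exact: Oh_cst|exact: Oh_cst|exact: a0O|].
  by apply: OhMl a1O; exact: Oh_cst.
- move=> j t j4; rewrite rmorphD/=; apply: cauchy_prod_harmonic => //.
  by rewrite taylor_coef0.
Qed.

(** L w is the derivative of the flux, hence the series is that of u'. *)
Lemma expands_Lop (e : int) f w u : smooth_in 5 (box lo hi) k f ->
  smooth_in 6 (box lo hi) k w -> (forall y, box lo hi y -> 0 < f y) ->
  away h (fun t => f (x t)) -> reaches e ->
  (forall j, (j < 5)%N -> Oh h 0 (u j)) ->
  (forall j t, (j < 5)%N -> cauchy_prod u (tc f) j t = dseries (tc w) j t) ->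
  expands h 4 (fun t => Lop (box lo hi) k f w (node (step t) (at_ t e)))
    (sample (dseries u) e%:~R).
Proof.
move=> fs ws f0 fa re uO us.
have ex p g : smooth_in p (box lo hi) k g ->
    expands h p (fun t => g (node (step t) (at_ t e))) (sample (tc g) e%:~R).
  by move=> gs; exact: (expands_node step_gt0 in_box gs re).
have dE p g : smooth_in p.+1 (box lo hi) k g ->
    expands h p (fun t => pderiv (box lo hi) k g (node (step t) (at_ t e)))
      (sample (dseries (tc g)) e%:~R).
  move=> gs; apply: eq_expands (ex _ _ (smooth_in_pderiv gs)); first exact: nearW.
  by move=> j t _; rewrite /sample /dseries taylor_coef_pderiv.
have Hf := ex 4 f (smooth_in_le (isT : (4 <= 5)%N) fs).
have Hf' := dE 4 f fs.
have Hw' := dE 4 w (smooth_in_le (isT : (5 <= 6)%N) ws).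
have Hw'' : expands h 4 (fun t => pderiv (box lo hi) k (pderiv (box lo hi) k w)
    (node (step t) (at_ t e))) (sample (dseries (dseries (tc w))) e%:~R).
  apply: eq_expands (dE 4 _ (smooth_in_pderiv ws)); first exact: nearW.
  by move=> j t _; rewrite /sample /dseries taylor_coef_pderiv.
have fa' : away h (fun t => f (node (step t) (at_ t e))).
  apply: (expands_away step_gt0 Hf); have [d d0 Hd] := fa; exists d => //.
  by apply: filterS Hd => t; rewrite /sample expr0 mul1r taylor_coef0.
apply: (expands_quotient step_gt0 (awayM fa' fa') _ _ _
  (expandsM step_gt0 Hf Hf) (expandsB (expandsM step_gt0 Hw'' Hf) (expandsM step_gt0 Hw' Hf'))).
- apply: nearW => t; have Bt := node_in_box t re.
  have ft := lt0r_neq0 (f0 _ Bt).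
  have fd : pderivable (box lo hi) k f (node (step t) (at_ t e)).
    by have [+ _] := fs => /(_ 0%N isT); exact.
  have wd : pderivable (box lo hi) k (pderiv (box lo hi) k w) (node (step t) (at_ t e)).
    by have [+ _] := ws => /(_ 1%N isT); exact.
  rewrite /Lop (pderiv_quotient (increments_proper lohi Bt) ft fd wd).
  by rewrite -expr2 divfK// expf_neq0.
- move=> j j4; apply: OhMl; first exact: Oh_cst.
  by apply: OhMl; [exact: Oh_cst|exact: uO].
- by move=> j t j4; exact: cauchy_prod_flux.
Qed.

Lemma expands_difference p (w : 'rV[R]_n -> R) (e : int) : smooth_in p.+1 (box lo hi) k w ->
  reaches e ->
  expands h p (fun t => (w (node (step t) (at_ t e)) - w (x t)) / h t)
    (fun j t => e%:~R ^+ j.+1 * tc w j.+1 t).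
Proof.
move=> ws re; have /(expandsS step_gt0)[_] := expands_node step_gt0 in_box ws re.
by apply: eq_expands => //; apply: nearW => t; rewrite expr0 mul1r taylor_coef0.
Qed.

End MeshFunctions.

(** * The order of consistency *)

(** Multiplied by h and by the two mean values, the defect of the scheme is the
polynomial expression of [defect_expansion]. *)
Lemma defect_factor {R : realType} (h c L Mp Mm wp w0 wm Vp Vm : R) :
  h != 0 -> c != 0 -> Mp != 0 -> Mm != 0 ->
  h ^+ 1 * ((h^-1 * ((wp - w0) / (Mp * h) - (w0 - wm) / (Mm * h))
    - (c^-1 * (c * L) + h ^+ 2 / 12 *
        (h^-1 * ((Vp - c * L) / (Mp * h) - (c * L - Vm) / (Mm * h))))) * (Mp * Mm)) =
  (wp - w0) / h * Mm - (w0 - wm) / h * Mp - h * (L * (Mp * Mm))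
    - h * (12^-1 * ((Vp - c * L) * Mm - (c * L - Vm) * Mp)).
Proof. by move=> h0 c0 Mp0 Mm0; field; rewrite h0 c0 Mp0 Mm0. Qed.

Section Consistency.
Context {R : realType} {n : nat} (k : 'I_n) (X lo hi : 'rV[R]_n).
Context (X_gt0 : 0 < X 0 k) (lohi : lo 0 k < hi 0 k) (box_sub : box 0 X `<=` box lo hi).
Context {T : Type} (step : T -> 'rV[R]_n) (idx : T -> 'rV[int]_n).
Context (step_gt0 : forall t, 0 < step t 0 k).
Context (in_box : forall t, box 0 X (node (step t) (idx t))).

Local Notation h := (fun t => step t 0 k).
Local Notation x t := (node (step t) (idx t)).

(** The box from lo to hi has to contain the points where the mean values that
define sigma^(k) are taken: one cell beyond the neighbours of the node if
sigma^(k) is the harmonic mean. *)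
Lemma consistency (c : coef_choice) r sigma w :
  (forall y, box 0 X y -> 0 < sigma y) ->
  smooth_in 6 (box 0 X) k sigma -> smooth_in 6 (box 0 X) k w ->
  smooth_in 6 (box lo hi) k sigma ->
  (forall e : int, `|e| <= 1 -> reaches k 0 X step idx e) ->
  (forall e : int, `|e| <= (if c is HarmonicCoef then 2 else 1) ->
     reaches k lo hi step idx e) ->
  Oh h 4 (fun t => Lambda r (step t) k sigma (fun j => w (node (step t) j)) (idx t)
    - sop c r (step t) k sigma (fun j => coef c r (step t) k sigma j *
        Lop (box 0 X) k sigma w (node (step t) j)) (idx t)).
Proof.
move=> sig0 sigs ws sigs' re re'.
have X0 : (0 : 'rV[R]_n) 0 k < X 0 k by rewrite mxE.
have Bx t : box lo hi (x t) by exact/box_sub/in_box.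
pose s j t := taylor_coef k 0 X sigma j (x t).
pose wc j t := taylor_coef k 0 X w j (x t).
have sO j : (j <= 6)%N -> Oh h 0 (s j).
  by move=> j6; exact: (Oh_taylor_coef _ in_box j6 sigs).
have wO j : (j <= 6)%N -> Oh h 0 (wc j).
  by move=> j6; exact: (Oh_taylor_coef _ in_box j6 ws).
have [d d0 Hd] := box_away ((proj2 sigs) 0%N isT) sig0.
have sa : away h (fun t => sigma (x t)).
  by exists d => //; apply: nearW => t; exact: Hd.
have s0 : s 0%N = fun t => sigma (x t) by apply/funext => t; rewrite /s taylor_coef0.
have sn0 t : sigma (x t) != 0 by rewrite gt_eqF// sig0.
have sE j t : (j < 4)%N -> taylor_coef k lo hi sigma j (x t) = s j t.
  move=> j4; rewrite /s /taylor_coef.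
  rewrite (iter_pderiv_subset box_sub _ sigs')//; last by rewrite (leq_trans (ltnW j4)).
  by move=> y; exact: increments_proper.
(* u is the series of the flux w'/sigma. *)
have [||j j5|j j5|u [uO us]] := @cauchy_prod_solve R T h 5 s (dseries wc).
- by rewrite s0.
- by move=> t; rewrite s0.
- by apply: sO; exact: ltnW (leq_trans j5 _).
- by apply: OhMl; [exact: Oh_cst|exact/wO/(leq_trans j5)].
have [a0 [a1 Hc]] := expands_coef lohi step_gt0 Bx r (smooth_in_le (isT : (4 <= 6)%N) sigs')
  sn0 sa re'.
have {}Hc (e : int) : `|e| <= 1 -> expands h 4
    (fun t => coef c r (step t) k sigma (idx t + e *: evec int k))
    (corrected s a0 a1 e%:~R).
  move=> e1; apply: eq_expands (Hc e e1); first exact: nearW.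
  by move=> j t j4; rewrite /corrected sE.
pose L (e : int) t := Lop (box 0 X) k sigma w (node (step t) (idx t + e *: evec int k)).
pose M (e : int) t := mean r (step t) k sigma (idx t + e *: evec int k).
pose V (e : int) t := coef c r (step t) k sigma (idx t + e *: evec int k) * L e t.
have HL (e : int) : `|e| <= 1 -> expands h 4 (L e) (sample (dseries u) e%:~R).
  move=> e1; apply: (expands_Lop X0 step_gt0 in_box _ ws sig0 sa (re e e1) uO us).
  exact: smooth_in_le sigs.
have HV (e : int) : `|e| <= 1 -> expands h 4 (V e) _ :=
  fun e1 => expandsM step_gt0 (Hc e e1) (HL e e1).
have r0 := re 0 isT; have r1 := re 1 isT; have rN1 := re (-1) isT.
have HM (e : int) : reaches k 0 X step idx (e - 1) -> reaches k 0 X step idx e ->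
    expands h 5 (M e) (fun j t => moment r e%:~R j * s j t).
  move=> re1 re0; apply: (expands_mean X0 step_gt0 in_box).
  - exact: smooth_in_le sigs.
  - by move=> t; have /andP[+ _] := re1 t; rewrite rmorphB.
  - by move=> t; have /andP[] := re0 t.
have Ma (e : int) : reaches k 0 X step idx (e - 1) -> reaches k 0 X step idx e ->
    away h (M e).
  by move=> *; apply: (away_mean X0) => //; exact: smooth_in_le sigs.
have Hp := HM 1 r0 r1; have Hm := HM 0 rN1 r0.
have ap := Ma 1 r0 r1; have am := Ma 0 rN1 r0.
have HDp : expands h 5 (fun t => (w (node (step t) (idx t + 1 *: evec int k)) - w (x t)) / h t)
    (fun j t => wc j.+1 t).
  apply: eq_expands (expands_difference step_gt0 in_box ws r1); first exact: nearW.
  by move=> j t _; rewrite expr1n mul1r.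
have HDm : expands h 5 (fun t => (w (x t) - w (node (step t) (idx t + -1 *: evec int k))) / h t)
    (fun j t => (-1) ^+ j * wc j.+1 t).
  apply: eq_expands (expandsN (expands_difference step_gt0 in_box ws rN1)).
    by apply: nearW => t; rewrite -mulNr opprB.
  by move=> j t _; rewrite exprS mulN1r mulNr opprK.
have := defect_expansion step_gt0 us HDp HDm Hp Hm (HL 0 isT) (HV 1 isT) (HV 0 isT) (HV (-1) isT).
set F := (X in Oh h 5 X) => HF.
set E := (X in Oh h 4 X).
have HE : Oh h (1 + 4) (fun t => h t ^+ 1 * (E t * (M 1 t * M 0 t))).
  have c0 := away_neq0 (expands_away step_gt0 (Hc 0 isT) _).
  have {}c0 : \forall t \near refinement h, coef c r (step t) k sigma (idx t + 0 *: evec int k) != 0.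
    apply: c0; have [b b0 Hb] := sa; exists b => //; apply: filterS Hb => t.
    by rewrite /corrected expr0 mul1r addr0 s0.
  apply: Oh_near HF; apply: filterS3 c0 (away_neq0 ap) (away_neq0 am) => t.
  have hn0 : step t 0 k != 0 by rewrite gt_eqF.
  rewrite /E /F /M /V /L /Lambda /sop /Lambda scale1r scaleN1r scale0r addr0.
  by move=> c0 Mp0 Mm0; rewrite defect_factor.
have {}HE := (Oh_shift step_gt0 1 4 _).1 HE.
apply: Oh_near (OhMr HE (OhV (awayM ap am))).
apply: filterS2 (away_neq0 ap) (away_neq0 am) => t Mp0 Mm0.
by rewrite mulfK// mulf_neq0.
Qed.

End Consistency.

(** * Inner nodes of a mesh *)

Section InnerNodes.
Context {R : realType} {n : nat} (X : 'rV[R]_n) (X_gt0 : forall l, 0 < X 0 l).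

Lemma cboxE : cbox X = box 0 X.
Proof. by apply/seteqP; split=> x Bx l; have := Bx l; rewrite mxE. Qed.

Lemma ext_cboxE k :
  ext_cbox X k = box (- (X 0 k *: evec R k)) (X + X 0 k *: evec R k).
Proof.
apply/seteqP; split=> x Bx l; have := Bx l; rewrite !mxE eqxx /=;
  case: eqP => [->|_]; rewrite ?mulr1 ?mulr0 ?oppr0 ?addr0//.
  by rewrite mulr_natl mulr2n.
by rewrite mulr_natl mulr2n.
Qed.

Context (k : 'I_n).

(** The configurations: a mesh and a node on it vary together, so that the final
constant depends on neither. *)
Record inner_node := InnerNode {
  cells : 'I_n -> nat;
  index : 'rV[int]_n;
  cells_ge2 : forall l, (2 <= cells l)%N;
  index_inner : inner_mesh cells index }.

Implicit Types t : inner_node.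

Lemma mesh_step_gt0 t l : 0 < mesh_step X (cells t) 0 l.
Proof. by rewrite mxE divr_gt0// ltr0n (leq_trans _ (cells_ge2 t l)). Qed.

Lemma mesh_step_cells t l : (cells t l)%:R * mesh_step X (cells t) 0 l = X 0 l.
Proof.
rewrite mxE mulrC divfK// pnatr_eq0 -lt0n.
exact: leq_trans (cells_ge2 t l).
Qed.

Lemma mesh_step_range t l (p q : nat) (z : int) :
  - (p * cells t l)%:Z <= z <= (q * cells t l)%:Z ->
  - (p%:R * X 0 l) <= z%:~R * mesh_step X (cells t) 0 l <= q%:R * X 0 l.
Proof.
move=> /andP[zp zq]; rewrite -(mesh_step_cells t l) !mulrA -mulNr -!natrM.
by rewrite !ler_pM2r ?mesh_step_gt0// !pmulrn -rmorphN/= !ler_int zp.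
Qed.

Lemma shifted_index_bounds t l (e : int) : `|e| <= 1 ->
  0 <= ((index t 0 l)%:~R + e%:~R) * mesh_step X (cells t) 0 l <= X 0 l.
Proof.
move=> e1; have il := index_inner t l.
have b : - (0 * cells t l)%:Z <= index t 0 l + e <= (1 * cells t l)%:Z.
  by apply/andP; split; lia.
by have := mesh_step_range b; rewrite intrD mul0r oppr0 mul1r.
Qed.

Lemma inner_node_in_box t : box 0 X (node (mesh_step X (cells t)) (index t)).
Proof.
by move=> l; have := @shifted_index_bounds t l 0 isT; rewrite !mxE addr0.
Qed.

Lemma reaches_box (e : int) : `|e| <= 1 ->
  reaches k 0 X (fun t => mesh_step X (cells t)) index e.
Proof.
move=> e1 t; have := shifted_index_bounds t k e1.
by rewrite mulrDl [node _ _ _ _]mxE [(0 : 'rV_n) 0 k]mxE.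
Qed.

Lemma ext_lo_coord : (- (X 0 k *: evec R k)) 0 k = - X 0 k.
Proof. by rewrite !mxE !eqxx mulr1. Qed.

Lemma ext_hi_coord : (X + X 0 k *: evec R k) 0 k = X 0 k + X 0 k.
Proof. by rewrite !mxE !eqxx mulr1. Qed.

Lemma reaches_ext_box (e : int) : `|e| <= 2 ->
  reaches k (- (X 0 k *: evec R k)) (X + X 0 k *: evec R k)
    (fun t => mesh_step X (cells t)) index e.
Proof.
move=> e2 t; have ik := index_inner t k; have ck := cells_ge2 t k.
have b : - (1 * cells t k)%:Z <= index t 0 k + e <= (2 * cells t k)%:Z.
  by apply/andP; split; lia.
have := mesh_step_range b; rewrite intrD mulrDl mul1r mulr_natl mulr2n.
by rewrite ext_lo_coord ext_hi_coord [node _ _ _ _]mxE.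
Qed.

Lemma ext_box_range : (- (X 0 k *: evec R k)) 0 k < (X + X 0 k *: evec R k) 0 k.
Proof. by have := X_gt0 k; rewrite ext_lo_coord ext_hi_coord => ?; lra. Qed.

Lemma box_sub_ext : box 0 X `<=` box (- (X 0 k *: evec R k)) (X + X 0 k *: evec R k).
Proof.
move=> x Bx l; have := Bx l; have := X_gt0 l; rewrite !mxE !eqxx /=.
by case: eqP => [->|_] /ltW ? /andP[? ?]; rewrite ?mulr1 ?mulr0; apply/andP; split; lra.
Qed.

End InnerNodes.

Theorem proposition1 (R : realType) :
  exists m : nat,
  forall (n : nat) (hn : (1 <= n)%N) (X : 'rV[R]_n) (hX : forall l, 0 < X 0 l)
    (k : 'I_n) (sigma w : 'rV[R]_n -> R) (r : mean_rule) (c : coef_choice)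
    (sigma_gt0 : forall x, cbox X x -> 0 < sigma x)
    (sigma_smooth : smooth_in m (cbox X) k sigma)
    (w_smooth : smooth_in m (cbox X) k w)
    (sigma_ext_smooth : c = HarmonicCoef -> smooth_in m (ext_cbox X k) k sigma),
  exists C h0 : R, [/\ 0 < C, 0 < h0 &
    forall N : 'I_n -> nat, (forall l, (2 <= N l)%N) ->
    let h := mesh_step X N in
    h 0 k <= h0 ->
    forall i : 'rV[int]_n, inner_mesh N i ->
    `| Lambda r h k sigma (fun j => w (node h j)) i
       - sop c r h k sigma
           (fun j => coef c r h k sigma j * Lop (cbox X) k sigma w (node h j)) i |
    <= C * h 0 k ^+ 4].
Proof.
(* The differences of w are divided by h twice, so that the remainder O(h^4)
   needs w(x +- h) up to O(h^6). *)
exists 6%N => n _ X X0 k sigma w r c; rewrite cboxE ext_cboxE => sig0 sigs ws sigs'.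
suff [C [h0 /= h00 HC]] : Oh (fun t : inner_node => mesh_step X (cells t) 0 k) 4
    (fun t => let h := mesh_step X (cells t) in
      Lambda r h k sigma (fun j => w (node h j)) (index t)
      - sop c r h k sigma (fun j => coef c r h k sigma j *
          Lop (box 0 X) k sigma w (node h j)) (index t)).
  exists (`|C| + 1), h0; split=> //.
  move=> N N2 hh0 i Ni; apply: le_trans (HC (InnerNode N2 Ni) hh0) _.
  apply: ler_wpM2r; last by rewrite (le_trans (ler_norm C))// lerDl.
  by rewrite exprn_ge0// ltW// (mesh_step_gt0 X0 (InnerNode N2 Ni)).
have X0k : (0 : 'rV[R]_n) 0 k < X 0 k by rewrite mxE.
have h_gt0 t : 0 < mesh_step X (cells t) 0 k := mesh_step_gt0 X0 t k.
have in_box := inner_node_in_box X0.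
have reach := reaches_box X0 k.
case: c sigs' => sigs'.
  exact: (consistency (X0 k) X0k (@subset_refl _ _) h_gt0 in_box).
apply: (consistency (X0 k) (ext_box_range X0 k) (box_sub_ext X0 k) h_gt0 in_box) => //.
  exact: sigs'.
exact: reaches_ext_box.
Qed.
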